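(* Let $F,g:\mathbb R\to\mathbb R$ satisfy (H1) and (H2) of the context, and let $a$, $c$ and $I$ be as defined there. Then the function $v\mapsto I(v,-a,c)$, $v\in(0,+\infty)$, has a unique positive zero, and $I(v,-a,c)$ changes sign at this zero.
   Context: Hypothesis (H1): $F$ and $g$ are odd functions in $C^1(\mathbb R)$, $g(x)>0$ for $x>0$, $F'(0)<0$, $F'$ has a unique positive zero, located at $x=a$, and $\lim_{x\to+\infty}F(x)=+\infty$. Under (H1), $F$ is strictly decreasing on $(-a,a)$ and strictly increasing elsewhere, $F$ has a unique positive zero $b>a$, and the equation $F(x)=F(-a)$ has a unique positive root $c$, with $c>b$. Hypothesis (H2): $F'(x)/g(x)$ is nondecreasing on $(0,c)$. For $v>0$ let $\bar\zeta(v)>c$ be the unique real root of $F(x)-F(c)=v$. For $v>0$ and $x,u<\bar\zeta(v)$ define $$I(v,x,u):=\int_x^u\frac{g(s)}{F(s)-F(c)-v}\,\mathrm ds,$$ which is well defined because $F(s)<F(c)+v$ for $s<\bar\zeta(v)$. *)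

(* Defs.v *)
From Stdlib Require Import Reals.
From Coquelicot Require Import Coquelicot.
Open Scope R_scope.

Definition odd_fun (f : R -> R) : Prop := forall x : R, f (- x) = - f x.

Definition C1 (f : R -> R) : Prop :=
  forall x : R, ex_derive f x /\ continuous (Derive f) x.

Definition H1 (F g : R -> R) (a : R) : Prop :=
  odd_fun F /\ odd_fun g /\ C1 F /\ C1 g /\
  (forall x : R, 0 < x -> 0 < g x) /\
  Derive F 0 < 0 /\
  (0 < a /\ Derive F a = 0 /\
   forall x : R, 0 < x -> Derive F x = 0 -> x = a) /\
  is_lim F p_infty p_infty.

(* Under [H1] exactly one such [c] exists, so uniqueness need not be required. *)
Definition positive_root_c (F : R -> R) (a c : R) : Prop :=
  0 < c /\ F c = F (- a).

Definition H2 (F g : R -> R) (c : R) : Prop :=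
  forall x y : R, 0 < x -> x <= y -> y < c ->
    Derive F x / g x <= Derive F y / g y.

(* [RInt] is total. For [v > 0] and [x], [u] below the unique root of
   [F s - F c = v], the denominator is negative on the whole segment, so this
   is a genuine Riemann integral; in particular for [x = - a] and [u = c]. *)
Definition I_int (F g : R -> R) (c v x u : R) : R :=
  RInt (fun s => g s / (F s - F c - v)) x u.

Definition changes_sign_at (f : R -> R) (x0 : R) : Prop :=
  exists eps : R, 0 < eps /\
    ((forall x y : R, x0 - eps < x < x0 -> x0 < y < x0 + eps ->
        f x < 0 /\ 0 < f y) \/
     (forall x y : R, x0 - eps < x < x0 -> x0 < y < x0 + eps ->
        0 < f x /\ f y < 0)).

(* Main.v *)
(* Since [F (-a) = F c], the integral of [F' / (F - F c - v)] over [[-a,c]] vanishes, so [g] may be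
   replaced by [g - kappa F'] in [I(v,-a,c)] for any [kappa]. Monotonicity of [F'/g] yields [kappa] and
   a level [w0 <= F c] such that [g - kappa F'] and [w0 - F] have the same sign on [(-a,c)]. For
   [v1 < v2] the difference of the weights [(F c + v - w0) / (F - F c - v)] at [v1] and [v2] is a
   positive multiple of [w0 - F], so [(F c + v - w0) * I(v,-a,c)] is strictly decreasing in [v]. It is
   positive for small [v], where the flat maximum of [F] at [-a] dominates, and negative for large [v]. *)
Require Import Defs.
From Stdlib Require Import Reals.
From Coquelicot Require Import Coquelicot.
From Stdlib Require Import Lra Ranalysis5 Classical.
Open Scope R_scope.

(** * Auxiliary facts on continuity, intermediate values and Riemann integrals *)

Lemma continuous_eps (f : R -> R) (x : R) (hf : continuous f x) (e : R) (he : 0 < e) :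
  exists d : R, 0 < d /\ forall y : R, Rabs (y - x) < d -> Rabs (f y - f x) < e.
Proof.
  apply filterlim_locally with (eps := mkposreal e he) in hf.
  destruct hf as [d hd].
  exists d; split; [apply cond_pos|].
  intros y hy; exact (hd y hy).
Qed.

Lemma continuous_Rmult (f h : R -> R) (x : R) :
  continuous f x -> continuous h x -> continuous (fun y => f y * h y) x.
Proof. exact (continuous_mult f h x). Qed.

Lemma continuous_Rminus (f h : R -> R) (x : R) :
  continuous f x -> continuous h x -> continuous (fun y => f y - h y) x.
Proof. exact (continuous_minus f h x). Qed.

Lemma continuous_Rdiv (f h : R -> R) (x : R) :
  continuous f x -> continuous h x -> h x <> 0 -> continuous (fun y => f y / h y) x.
Proof.
  intros hf hh hx.
  apply continuous_Rmult; [exact hf|].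
  apply continuous_Rinv_comp; assumption.
Qed.

Lemma ivt_continuous (f : R -> R) (x y w : R) (hf : forall z : R, continuous f z) :
  x <= y -> Rmin (f x) (f y) <= w <= Rmax (f x) (f y) ->
  exists z : R, x <= z <= y /\ f z = w.
Proof.
  intros hxy hw.
  destruct (IVT_gen f x y w) as [z [hz ez]]; auto.
  - intros z. apply continuity_pt_filterlim, hf.
  - exists z. rewrite Rmin_left, Rmax_right in hz by lra. auto.
Qed.

Lemma incr_of_Derive_pos (f : R -> R) (x y : R) :
  (forall z : R, ex_derive f z) -> x < y ->
  (forall z : R, x < z < y -> 0 < Derive f z) -> f x < f y.
Proof.
  intros hf hxy hd.
  destruct (MVT_cor2 f (Derive f) x y hxy) as [z [ez hz]].
  - intros z _. apply is_derive_Reals, Derive_correct, hf.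
  - assert (0 < Derive f z * (y - x)) by (apply Rmult_lt_0_compat; [auto|lra]).
    lra.
Qed.

Lemma Derive_odd (f : R -> R) (x : R) :
  odd_fun f -> ex_derive f x -> Derive f (- x) = Derive f x.
Proof.
  intros ho hd.
  apply is_derive_unique.
  apply is_derive_ext with (f := fun y => - f (- y)).
  - intros y. rewrite ho. lra.
  - auto_derive; rewrite Ropp_involutive; [exact hd|].
    change (Derive (fun y => f y) x) with (Derive f x). ring.
Qed.

Lemma C1_continuous (f : R -> R) (x : R) : Defs.C1 f -> continuous f x.
Proof. intros hf. apply (ex_derive_continuous f x), hf. Qed.

Lemma odd_fun_0 (f : R -> R) : odd_fun f -> f 0 = 0.
Proof. intros ho. specialize (ho 0). rewrite Ropp_0 in ho. lra. Qed.

Lemma continuous_bounded (f : R -> R) (p q : R) :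
  p <= q -> (forall x : R, continuous f x) ->
  exists C : R, 0 < C /\ forall x : R, p <= x <= q -> Rabs (f x) <= C.
Proof.
  intros hpq hf.
  destruct (continuity_ab_maj (fun x => Rabs (f x)) p q hpq) as [z [hz _]].
  - intros x _. apply continuity_pt_filterlim.
    apply (continuous_comp f Rabs); [apply hf|apply continuous_Rabs].
  - exists (Rabs (f z) + 1). split; [generalize (Rabs_pos (f z)); lra|].
    intros x hx. specialize (hz x hx). simpl in hz. lra.
Qed.

Lemma ex_RInt_continuous_le (f : R -> R) (p q : R) :
  p <= q -> (forall x : R, p <= x <= q -> continuous f x) -> ex_RInt f p q.
Proof.
  intros hpq hf. apply (ex_RInt_continuous f).
  rewrite Rmin_left, Rmax_right by lra. exact hf.
Qed.

Lemma RInt_Rchasles (f : R -> R) (p q r : R) :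
  p <= q <= r -> (forall x : R, p <= x <= r -> continuous f x) ->
  RInt f p r = RInt f p q + RInt f q r.
Proof.
  intros hpq hf. symmetry. apply (RInt_Chasles f p q r);
  apply ex_RInt_continuous_le; try lra; intros x hx; apply hf; lra.
Qed.

Lemma RInt_lin (f h : R -> R) (k p q : R) :
  p <= q -> (forall x : R, p <= x <= q -> continuous f x) ->
  (forall x : R, p <= x <= q -> continuous h x) ->
  RInt (fun x => f x + k * h x) p q = RInt f p q + k * RInt h p q.
Proof.
  intros hpq hf hh.
  assert (ef := ex_RInt_continuous_le f p q hpq hf).
  assert (eh := ex_RInt_continuous_le h p q hpq hh).
  apply is_RInt_unique.
  apply (is_RInt_plus f (fun x => k * h x)).
  - apply (RInt_correct f), ef.
  - apply (is_RInt_scal h), (RInt_correct h), eh.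
Qed.

Lemma RInt_nonneg (f : R -> R) (p q : R) :
  p <= q -> (forall x : R, p <= x <= q -> continuous f x) ->
  (forall x : R, p < x < q -> 0 <= f x) -> 0 <= RInt f p q.
Proof. intros hpq hf h0. apply RInt_ge_0; auto. apply ex_RInt_continuous_le; auto. Qed.

(** Prepared for the monotonicity argument in [v], where the integrand on [[-a,c]] is known to be
    strictly positive only on [(0,a)]. *)
Lemma RInt_pos_of_sub (f : R -> R) (p r1 r2 q : R) :
  p <= r1 -> r1 < r2 -> r2 <= q ->
  (forall x : R, p <= x <= q -> continuous f x) ->
  (forall x : R, p < x < q -> 0 <= f x) ->
  (forall x : R, r1 < x < r2 -> 0 < f x) -> 0 < RInt f p q.
Proof.
  intros h1 h2 h3 hf h0 hp.
  rewrite (RInt_Rchasles f p r1 q), (RInt_Rchasles f r1 r2 q); try lra;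
    try (intros x hx; apply hf; lra).
  assert (0 <= RInt f p r1) by (apply RInt_nonneg; intros; [lra|apply hf; lra|apply h0; lra]).
  assert (0 <= RInt f r2 q) by (apply RInt_nonneg; intros; [lra|apply hf; lra|apply h0; lra]).
  assert (0 < RInt f r1 r2) by (apply RInt_gt_0; auto; intros; apply hf; lra).
  lra.
Qed.

(** The substitution [y -> -y] turns the integral into its own negative. *)
Lemma RInt_odd (f : R -> R) (r : R) :
  0 <= r -> odd_fun f -> (forall x : R, continuous f x) -> RInt f (- r) r = 0.
Proof.
  intros hr ho hf.
  assert (h : is_RInt f r (- r) (RInt f (- r) r)).
  { apply is_RInt_ext with (f := fun y => opp (f (- y))).
    - intros x _. rewrite ho. apply Ropp_involutive.
    - apply (is_RInt_comp_opp f). rewrite Ropp_involutive.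
      apply (RInt_correct f), ex_RInt_continuous_le; [lra|auto]. }
  apply (is_RInt_unique f) in h.
  rewrite <- (opp_RInt_swap f) in h.
  - unfold opp in h; simpl in h. lra.
  - apply ex_RInt_continuous_le; [lra|auto].
Qed.

(** * Shape of [F] under (H1) *)

Section Shape.
Context (F g : R -> R) (a : R) (hH : H1 F g a).

Lemma H1_F_continuous (x : R) : continuous F x.
Proof. destruct hH as (_ & _ & hF & _). apply C1_continuous, hF. Qed.

Lemma H1_g_continuous (x : R) : continuous g x.
Proof. destruct hH as (_ & _ & _ & hg & _). apply C1_continuous, hg. Qed.

Lemma H1_Derive_continuous (x : R) : continuous (Derive F) x.
Proof. destruct hH as (_ & _ & hF & _). apply hF. Qed.

(** Since [F'(0) < 0], a nonnegative value at [x] would yield, by intermediate values, a positive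
    zero of [F'] below [a], against uniqueness. *)
Lemma H1_Derive_neg (x : R) : 0 <= x < a -> Derive F x < 0.
Proof.
  destruct hH as (_ & _ & hF & _ & _ & h0 & (ha & _ & hu) & _).
  intros hx. apply Rnot_le_lt. intros hp.
  destruct (ivt_continuous (Derive F) 0 x 0) as [z [hz ez]].
  - intros z; apply hF.
  - lra.
  - rewrite Rmin_left, Rmax_right; lra.
  - assert (0 < z) by (destruct (Req_dec z 0); [subst; lra|lra]).
    specialize (hu z H ez). lra.
Qed.

(* A negative value of [F'] beyond [a] would persist by uniqueness of the zero, contradicting [F -> +oo]. *)
Lemma H1_Derive_pos (x : R) : a < x -> 0 < Derive F x.
Proof.
  destruct hH as (_ & _ & hF & _ & _ & h0 & (ha & _ & hu) & hl).
  intros hx. apply Rnot_le_lt. intros hp.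
  assert (hn : forall y, x < y -> Derive F y < 0).
  { intros y hy. apply Rnot_le_lt. intros hq.
    destruct (ivt_continuous (Derive F) x y 0) as [z [hz ez]].
    - intros z; apply hF.
    - lra.
    - rewrite Rmin_left, Rmax_right; lra.
    - assert (0 < z) as hz0 by lra. specialize (hu z hz0 ez). lra. }
  apply is_lim_spec in hl.
  destruct (hl (F x)) as [K hK].
  set (y := Rmax K x + 1).
  assert (K < y) by (unfold y; generalize (Rmax_l K x); lra).
  assert (x < y) by (unfold y; generalize (Rmax_r K x); lra).
  specialize (hK y H).
  enough (- F x < - F y) by lra.
  apply (incr_of_Derive_pos (fun z => - F z)); auto.
  - intros z. apply @ex_derive_opp, hF.
  - intros z hz. rewrite Derive_opp. specialize (hn z). lra.
Qed.

Lemma H1_decr (x y : R) : 0 <= x -> x < y -> y <= a -> F y < F x.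
Proof.
  intros hx hxy hy.
  enough (- F x < - F y) by lra.
  apply (incr_of_Derive_pos (fun z => - F z)); auto.
  - intros z. apply @ex_derive_opp, hH.
  - intros z hz. rewrite Derive_opp.
    assert (Derive F z < 0) by (apply H1_Derive_neg; lra). lra.
Qed.

Lemma H1_incr (x y : R) : a <= x -> x < y -> F x < F y.
Proof.
  intros hx hxy.
  apply incr_of_Derive_pos; auto.
  - intros z. apply hH.
  - intros z hz. apply H1_Derive_pos. lra.
Qed.

Lemma H1_incr_inv (x y : R) : a <= x -> a <= y -> F x < F y -> x < y.
Proof.
  intros hx hy h. apply Rnot_le_lt. intros [hc|hc].
  - generalize (H1_incr y x hy hc). lra.
  - subst. lra.
Qed.

Lemma H1_decr_inv (x y : R) : 0 <= x <= a -> 0 <= y <= a -> F x < F y -> y < x.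
Proof.
  intros hx hy h. apply Rnot_le_lt. intros [hc|hc].
  - generalize (H1_decr x y). lra.
  - subst. lra.
Qed.

Lemma H1_neg (x : R) : 0 < x <= a -> F x < 0.
Proof.
  intros hx. rewrite <- (odd_fun_0 F) by apply hH.
  apply H1_decr; lra.
Qed.

(** * The root [c] and the level [F c] *)

Context (c : R) (hc : positive_root_c F a c).

Lemma root_c_opp : F c = - F a.
Proof. destruct hc as [_ e]. rewrite e. apply hH. Qed.

Lemma root_c_pos : 0 < F c.
Proof.
  rewrite root_c_opp. assert (F a < 0); [|lra].
  apply H1_neg. destruct hH as (_ & _ & _ & _ & _ & _ & (ha & _) & _). lra.
Qed.

Lemma root_c_gt : a < c.
Proof.
  apply Rnot_le_lt. intros h.
  assert (F c < 0) by (apply H1_neg; destruct hc; lra).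
  generalize root_c_pos. lra.
Qed.

Lemma zero_b : exists b : R, a < b < c /\ F b = 0.
Proof.
  assert (0 < a) by apply hH.
  assert (F a < 0) by (apply H1_neg; lra).
  assert (0 < F c) by apply root_c_pos.
  assert (a < c) by apply root_c_gt.
  destruct (ivt_continuous F a c 0) as [b [hb eb]].
  - exact H1_F_continuous.
  - lra.
  - rewrite Rmin_left, Rmax_right; lra.
  - exists b; repeat split; auto.
    + destruct (Req_dec b a); [subst; lra|lra].
    + destruct (Req_dec b c); [subst; lra|lra].
Qed.

(** Three ranges: beyond [a], [F] increases; on [(0,a]], [F] is negative while [F c] is positive; on
    [(-a,0]], oddness reflects the decrease of [F] on [[0,a]], with [F c = - F a]. This keeps the
    denominators of [I] negative. *)
Lemma lt_F_c (s : R) : - a < s < c -> F s < F c.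
Proof.
  intros hs.
  assert (hp := root_c_pos).
  destruct (Rlt_le_dec a s) as [h|h].
  - apply H1_incr; lra.
  - destruct (Rlt_le_dec 0 s) as [h'|h'].
    + assert (F s < 0) by (apply H1_neg; lra). lra.
    + rewrite root_c_opp.
      replace (F s) with (- F (- s)).
      * assert (F a < F (- s)); [|lra]. apply H1_decr; lra.
      * rewrite (proj1 hH). lra.
Qed.

Lemma le_F_c (s : R) : - a <= s <= c -> F s <= F c.
Proof.
  intros hs.
  destruct (Req_dec s (- a)) as [-> |h].
  - destruct hc as [_ ->]; lra.
  - destruct (Req_dec s c) as [-> |h']; [lra|].
    left; apply lt_F_c; lra.
Qed.

(** * Monotonicity of [F'/g] and the sign of [g - kappa F'] *)

Context (hH2 : H2 F g c).

Definition ratio (x : R) : R := Derive F x / g x.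

Lemma H1_g_pos (x : R) : 0 < x -> 0 < g x.
Proof. apply hH. Qed.

Lemma ratio_continuous (x : R) : 0 < x -> continuous ratio x.
Proof.
  intros hx. apply continuous_Rdiv.
  - apply H1_Derive_continuous.
  - apply H1_g_continuous.
  - generalize (H1_g_pos x hx). lra.
Qed.

(** (H2) passes to the endpoint [c] by continuity of [ratio]; the endpoint matters because the
    crossing point [s0] may be [c]. *)
Lemma ratio_mono (x y : R) : 0 < x -> x <= y -> y <= c -> ratio x <= ratio y.
Proof.
  intros hx hxy hy.
  destruct (Rlt_le_dec y c) as [h|h]; [apply hH2; auto|].
  assert (y = c) by lra. subst y. clear h hy.
  destruct hxy as [hxc| ->]; [|lra].
  apply Rnot_lt_le. intros hlt.
  destruct (continuous_eps ratio c) with (e := ratio x - ratio c) as [d [hd hde]].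
  - apply ratio_continuous. lra.
  - lra.
  - set (s := Rmax x (c - d / 2)).
    assert (x <= s) by apply Rmax_l.
    assert (c - d / 2 <= s) by apply Rmax_r.
    assert (s < c) by (apply Rmax_lub_lt; lra).
    assert (hs := hde s).
    assert (Rabs (s - c) < d) as h1 by (apply Rabs_def1; lra).
    specialize (hs h1). apply Rabs_def2 in hs.
    assert (ratio x <= ratio s) by (apply hH2; lra). lra.
Qed.

(* The value [F s0] is where the two monotone functions [F'/g] along the branch [(b,c)]
   and [-F'/g] along the branch [(0,a)], both viewed as functions of [|F|], cross. *)
Lemma crossing :
  exists s0 : R, a < s0 <= c /\ 0 <= F s0 /\
    (forall t : R, 0 < t < a -> - F t < F s0 -> ratio t <= - ratio s0) /\
    (forall t : R, 0 < t < a -> F s0 < - F t -> - ratio s0 <= ratio t).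
Proof.
  destruct zero_b as [b [hb eb]].
  assert (ha : 0 < a) by apply hH.
  assert (hF0 : F 0 = 0) by (apply odd_fun_0, hH).
  assert (hcF := H1_F_continuous).
  assert (eca := root_c_opp). assert (hcp := root_c_pos).
  (* [s] and [-t] lie at the same level of [F], and [s0] is the supremum of the [s] at which the two
     branches have not yet crossed. The level [F b = 0] has no partner [t] in [(0,a)], so [b] is
     added by hand to make [S] nonempty. *)
  set (S := fun s => b <= s <= c /\ (s = b \/ exists t, 0 < t < a /\ F t = - F s /\
              ratio s + ratio t <= 0)).
  destruct (completeness S) as [s0 [hub hlub]].
  { exists c. intros s [hs _]; lra. }
  { exists b. split; [lra|auto]. }
  assert (hbs : b <= s0) by (apply hub; split; [lra|auto]).
  assert (hsc : s0 <= c) by (apply hlub; intros s [hs _]; lra).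
  assert (hFs0 : 0 <= F s0).
  { destruct hbs as [h|<-]; [|lra]. rewrite <- eb. left; apply H1_incr; lra. }
  assert (hFt : forall t, 0 < t < a -> 0 < - F t < F c).
  { intros t ht. rewrite eca.
    assert (F t < 0) by (apply H1_neg; lra).
    assert (F a < F t) by (apply H1_decr; lra). lra. }
  assert (hpair : forall t, 0 < t < a -> exists s, b <= s <= c /\ F s = - F t).
  { intros t ht. specialize (hFt t ht).
    apply (ivt_continuous F b c); [exact hcF|lra|].
    rewrite Rmin_left, Rmax_right; lra. }
  exists s0. repeat split; try lra.
  (* Below the level of [s0]: if [ratio s0 + ratio t > 0], take [s'] in [S] close to [s0] and above
     the partner [s] of [t]. Its partner [t'] exceeds [t], so [ratio s' + ratio t <= 0], against
     continuity of [ratio] at [s0]. *)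
  - intros t ht htl. apply Rnot_lt_le. intros hlt.
    destruct (hpair t ht) as [s [hs es]].
    assert (hss : s < s0) by (apply H1_incr_inv; lra).
    destruct (continuous_eps ratio s0) with (e := ratio s0 + ratio t) as [d [hd hde]].
    { apply ratio_continuous; lra. }
    { lra. }
    assert (exists s', S s' /\ Rmax s (s0 - d) < s') as [s' [hs' hgt]].
    { apply NNPP. intros hno.
      assert (s0 <= Rmax s (s0 - d)).
      { apply hlub. intros z hz. apply Rnot_lt_le. intros hz'. apply hno. eauto. }
      assert (Rmax s (s0 - d) < s0) by (apply Rmax_lub_lt; lra). lra. }
    assert (s < s') by (generalize (Rmax_l s (s0 - d)); lra).
    assert (s0 - d < s') by (generalize (Rmax_r s (s0 - d)); lra).
    assert (s' <= s0) by (apply hub; auto).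
    destruct hs' as [hbs' [hb'|[t' [ht' [et' hr]]]]]; [lra|].
    assert (F s < F s') by (apply H1_incr; lra).
    assert (t < t') by (apply H1_decr_inv; lra).
    assert (ratio t <= ratio t') by (apply ratio_mono; lra).
    assert (h1 : Rabs (s' - s0) < d) by (apply Rabs_def1; lra).
    specialize (hde s' h1). apply Rabs_def2 in hde. lra.
  (* Above the level of [s0]: a point [s'] slightly beyond [s0] and below the partner [s] of [t] is
     outside [S], and its own partner [t'] is less than [t]. Hence [ratio s' + ratio t > 0], again
     against continuity at [s0]. *)
  - intros t ht htl. apply Rnot_lt_le. intros hlt.
    destruct (hpair t ht) as [s [hs es]].
    assert (hss : s0 < s) by (apply H1_incr_inv; lra).
    destruct (continuous_eps ratio s0) with (e := - ratio s0 - ratio t) as [d [hd hde]].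
    { apply ratio_continuous; lra. }
    { lra. }
    set (s' := Rmin ((s0 + s) / 2) (s0 + d / 2)).
    assert (s' <= (s0 + s) / 2) by apply Rmin_l.
    assert (s' <= s0 + d / 2) by apply Rmin_r.
    assert (s0 < s') by (apply Rmin_glb_lt; lra).
    assert (F s0 < F s') by (apply H1_incr; lra).
    assert (F s' < F s) by (apply H1_incr; lra).
    assert (F s <= F c) by (apply le_F_c; lra).
    destruct (ivt_continuous F 0 a (- F s')) as [t' [ht' et']]; [exact hcF|lra| |].
    { rewrite Rmin_right, Rmax_left; lra. }
    assert (0 < t' < a).
    { split.
      - destruct (Req_dec t' 0); [subst t'; lra|lra].
      - destruct (Req_dec t' a); [subst t'; lra|lra]. }
    assert (t' < t) by (apply H1_decr_inv; lra).
    assert (ratio t' <= ratio t) by (apply ratio_mono; lra).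
    assert (0 < ratio s' + ratio t').
    { apply Rnot_le_lt. intros hle.
      assert (s' <= s0); [|lra].
      apply hub. split; [lra|]. right. exists t'. repeat split; lra. }
    assert (h1 : Rabs (s' - s0) < d) by (apply Rabs_def1; lra).
    specialize (hde s' h1). apply Rabs_def2 in hde. lra.
Qed.

(** Take [kappa = / ratio s0] and [w0 = F s0]. On [(0,a)] both factors are positive, since
    [F' < 0 < g] and [F < 0 <= F s0]. On [[a,c)] both change sign at [s0], by monotonicity of
    [ratio] and [F]. On [(-a,0)] the two inequalities of [crossing] apply after reflection. *)
Lemma sign_comparison :
  exists kappa w0 : R, w0 <= F c /\
    (forall s : R, - a < s < c -> 0 <= (g s - kappa * Derive F s) * (w0 - F s)) /\
    (forall s : R, 0 < s < a -> 0 < (g s - kappa * Derive F s) * (w0 - F s)).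
Proof.
  destruct crossing as [s0 [hs0 [hF0 [hlo hhi]]]].
  assert (ha : 0 < a) by apply hH.
  assert (hr0 : 0 < ratio s0).
  { apply Rdiv_lt_0_compat; [apply H1_Derive_pos|apply H1_g_pos]; lra. }
  assert (hk : 0 < / ratio s0) by (apply Rinv_0_lt_compat; auto).
  assert (eg : forall s, 0 < s ->
    g s - / ratio s0 * Derive F s = g s * / ratio s0 * (ratio s0 - ratio s)).
  { intros s hs. generalize (H1_g_pos s hs). intros hg.
    assert (ed : Derive F s = ratio s * g s) by (unfold ratio; field; lra).
    rewrite ed. field. lra. }
  assert (eg' : forall s, 0 < s ->
    g (- s) - / ratio s0 * Derive F (- s) = g s * / ratio s0 * (- ratio s0 - ratio s)).
  { intros s hs. generalize (H1_g_pos s hs). intros hg.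
    rewrite Derive_odd by apply hH. rewrite (proj1 (proj2 hH)).
    assert (ed : Derive F s = ratio s * g s) by (unfold ratio; field; lra).
    rewrite ed. field. lra. }
  assert (hgk : forall s, 0 < s -> 0 < g s * / ratio s0).
  { intros s hs. apply Rmult_lt_0_compat; [apply H1_g_pos|]; auto. }
  assert (hin : forall s, 0 < s < a -> 0 < (g s - / ratio s0 * Derive F s) * (F s0 - F s)).
  { intros s hs.
    assert (F s < 0) by (apply H1_neg; lra).
    apply Rmult_lt_0_compat; [|lra].
    assert (Derive F s < 0) by (apply H1_Derive_neg; lra).
    assert (0 < / ratio s0 * - Derive F s) by (apply Rmult_lt_0_compat; lra).
    generalize (H1_g_pos s (proj1 hs)). lra. }
  exists (/ ratio s0), (F s0). split; [apply le_F_c; lra|]. split; [|exact hin].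
  intros s hs.
  destruct (Rtotal_order s 0) as [h|[-> |h]].
  - replace s with (- - s) by lra.
    rewrite eg' by lra. rewrite (proj1 hH (- s)).
    rewrite Rmult_assoc.
    apply Rmult_le_pos; [left; apply hgk; lra|].
    destruct (Rtotal_order (- F (- s)) (F s0)) as [h'|[h'|h']].
    + assert (ratio (- s) <= - ratio s0) by (apply hlo; lra).
      apply Rmult_le_pos; lra.
    + rewrite h'. lra.
    + assert (- ratio s0 <= ratio (- s)) by (apply hhi; lra).
      rewrite <- Rmult_opp_opp. apply Rmult_le_pos; lra.
  - rewrite (odd_fun_0 F), (odd_fun_0 g) by apply hH.
    assert (Derive F 0 < 0) by apply hH.
    assert (0 < / ratio s0 * - Derive F 0) by (apply Rmult_lt_0_compat; lra).
    apply Rmult_le_pos; lra.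
  - destruct (Rlt_le_dec s a) as [h1|h1]; [left; apply hin; lra|].
    rewrite eg by lra. rewrite Rmult_assoc.
    apply Rmult_le_pos; [left; apply hgk; lra|].
    destruct (Rtotal_order s s0) as [h2|[-> |h2]].
    + assert (F s < F s0) by (apply H1_incr; lra).
      assert (ratio s <= ratio s0) by (apply ratio_mono; lra).
      apply Rmult_le_pos; lra.
    + lra.
    + assert (F s0 < F s) by (apply H1_incr; lra).
      assert (ratio s0 <= ratio s) by (apply ratio_mono; lra).
      rewrite <- Rmult_opp_opp. apply Rmult_le_pos; lra.
Qed.

(** * Rewriting of [I(v,-a,c)] and strict decrease of its weighted form *)

Lemma H1_comb_continuous (kappa x : R) : continuous (fun s => g s - kappa * Derive F s) x.
Proof.
  apply continuous_Rminus; [apply H1_g_continuous|].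
  apply continuous_Rmult; [apply continuous_const|apply H1_Derive_continuous].
Qed.

Lemma denom_le (v s : R) : - a <= s <= c -> F s - F c - v <= - v.
Proof. intros hs. generalize (le_F_c s hs). lra. Qed.

Lemma quot_continuous (u : R -> R) (v : R) (hu : forall x : R, continuous u x) :
  0 < v -> forall s : R, - a <= s <= c -> continuous (fun s => u s / (F s - F c - v)) s.
Proof.
  intros hv s hs. apply continuous_Rdiv; [apply hu| |].
  - apply (continuous_Rminus (fun s => F s - F c)); [|apply continuous_const].
    apply continuous_Rminus; [apply H1_F_continuous|apply continuous_const].
  - generalize (denom_le v s hs). lra.
Qed.

Lemma RInt_log (v p q : R) :
  0 < v -> - a <= p -> p <= q -> q <= c ->
  RInt (fun s => Derive F s / (F s - F c - v)) p q =
  ln (F c + v - F q) - ln (F c + v - F p).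
Proof.
  intros hv hp hpq hq.
  apply is_RInt_unique.
  apply (is_RInt_derive (fun s => ln (F c + v - F s)));
    rewrite Rmin_left, Rmax_right by lra; intros x hx.
  - assert (hd := denom_le v x).
    auto_derive.
    + repeat split; [apply hH|lra].
    + change (Derive (fun y => F y) x) with (Derive F x). field. lra.
  - apply quot_continuous; [apply H1_Derive_continuous|auto|lra].
Qed.

Lemma I_int_shift (kappa v : R) : 0 < v ->
  I_int F g c v (- a) c = RInt (fun s => (g s - kappa * Derive F s) / (F s - F c - v)) (- a) c.
Proof.
  intros hv.
  assert (ha : 0 < a) by apply hH. assert (hac := root_c_gt).
  transitivity (RInt (fun s => g s / (F s - F c - v) +
                     - kappa * (Derive F s / (F s - F c - v))) (- a) c).
  - rewrite RInt_lin.
    + rewrite RInt_log by lra. destruct hc as [_ <-]. unfold I_int. lra.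
    + lra.
    + apply quot_continuous; [apply H1_g_continuous|auto].
    + apply quot_continuous; [apply H1_Derive_continuous|auto].
  - apply RInt_ext. intros s _. unfold Rdiv. simpl. ring.
Qed.

Lemma weighted_I_decr (kappa w0 : R)
  (h0 : forall s : R, - a < s < c -> 0 <= (g s - kappa * Derive F s) * (w0 - F s))
  (hp : forall s : R, 0 < s < a -> 0 < (g s - kappa * Derive F s) * (w0 - F s))
  (v1 v2 : R) : 0 < v1 -> v1 < v2 ->
  (F c + v2 - w0) * I_int F g c v2 (- a) c < (F c + v1 - w0) * I_int F g c v1 (- a) c.
Proof.
  intros hv1 hv12.
  assert (ha : 0 < a) by apply hH. assert (hac := root_c_gt).
  rewrite (I_int_shift kappa v1), (I_int_shift kappa v2) by lra.
  set (u := fun s => g s - kappa * Derive F s) in *.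
  assert (hu : forall x, continuous u x) by apply H1_comb_continuous.
  set (A1 := F c + v1 - w0). set (A2 := F c + v2 - w0).
  assert (hu1 : forall x, continuous (fun s => A1 * u s) x).
  { intros x. apply continuous_Rmult; [apply continuous_const|apply hu]. }
  assert (e : forall A v, 0 < v -> A * RInt (fun s => u s / (F s - F c - v)) (- a) c =
     RInt (fun s => A * u s / (F s - F c - v)) (- a) c).
  { intros A v hv.
    transitivity (RInt (fun s => 0 + A * (u s / (F s - F c - v))) (- a) c).
    - rewrite (RInt_lin (fun _ => 0)).
      + rewrite (RInt_const (V := R_CompleteNormedModule)).
        unfold scal; simpl; unfold mult; simpl. ring.
      + lra.
      + intros; apply continuous_const.
      + apply quot_continuous; auto.
    - apply RInt_ext. intros; simpl. unfold Rdiv; ring. }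
  rewrite (e A1) by lra.
  apply Rminus_lt_0. unfold Rminus. rewrite Ropp_mult_distr_l.
  rewrite <- RInt_lin; [|lra|apply quot_continuous; auto; lra|apply quot_continuous; auto; lra].
  (* With [X = F s - F c], the weights are chosen so that [A1 * (X - v2) - A2 * (X - v1) = (v2 - v1)
     * (w0 - F s)]. *)
  assert (es : forall s, - a <= s <= c ->
    A1 * u s / (F s - F c - v1) + - A2 * (u s / (F s - F c - v2)) =
    (v2 - v1) / ((F s - F c - v1) * (F s - F c - v2)) * (u s * (w0 - F s))).
  { intros s hs. assert (d1 := denom_le v1 s hs). assert (d2 := denom_le v2 s hs).
    unfold A1, A2. field. lra. }
  assert (ew : forall s, - a <= s <= c ->
    0 < (v2 - v1) / ((F s - F c - v1) * (F s - F c - v2))).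
  { intros s hs. assert (d1 := denom_le v1 s hs). assert (d2 := denom_le v2 s hs).
    apply Rdiv_lt_0_compat; [lra|].
    rewrite <- Rmult_opp_opp. apply Rmult_lt_0_compat; lra. }
  apply RInt_pos_of_sub with (r1 := 0) (r2 := a); try lra.
  - intros s hs.
    apply (continuous_plus (fun s => A1 * u s / (F s - F c - v1))
             (fun s => - A2 * (u s / (F s - F c - v2)))).
    + apply quot_continuous; auto.
    + apply continuous_Rmult; [apply continuous_const|apply quot_continuous; auto; lra].
  - intros s hs. rewrite es by lra. apply Rmult_le_pos; [left; apply ew; lra|apply h0; lra].
  - intros s hs. rewrite es by lra. apply Rmult_lt_0_compat; [apply ew; lra|apply hp; lra].
Qed.

(** * Continuity of [I(v,-a,c)] in [v] and its signs for large and small [v] *)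

Lemma I_int_lipschitz (m : R) : 0 < m ->
  exists C : R, 0 < C /\ forall v1 v2 : R, m <= v1 -> m <= v2 ->
    Rabs (I_int F g c v1 (- a) c - I_int F g c v2 (- a) c) <= C * Rabs (v1 - v2).
Proof.
  intros hm.
  assert (ha : 0 < a) by apply hH. assert (hac := root_c_gt).
  destruct (continuous_bounded g (- a) c) as [G [hG hgG]]; [lra|apply H1_g_continuous|].
  (* The integrands differ by [g * (v1 - v2)] over the product of the two denominators; each
     denominator is at most [- m], and [G] bounds [g]. *)
  exists ((c - - a) * (G / (m * m))). split.
  { repeat (apply Rmult_lt_0_compat || apply Rinv_0_lt_compat || lra). }
  intros v1 v2 h1 h2.
  unfold I_int.
  replace (RInt (fun s => g s / (F s - F c - v1)) (- a) c -
           RInt (fun s => g s / (F s - F c - v2)) (- a) c)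
    with (RInt (fun s => g s / (F s - F c - v1) + -1 * (g s / (F s - F c - v2))) (- a) c).
  2:{ rewrite RInt_lin; [lra|lra| |]; apply quot_continuous; try apply H1_g_continuous; lra. }
  rewrite Rmult_assoc.
  apply abs_RInt_le_const; [lra| |].
  - apply ex_RInt_continuous_le; [lra|]. intros s hs.
    apply (continuous_plus (fun s => g s / (F s - F c - v1))
             (fun s => -1 * (g s / (F s - F c - v2)))).
    + apply quot_continuous; auto; try apply H1_g_continuous; lra.
    + apply continuous_Rmult; [apply continuous_const|apply quot_continuous; auto; try apply H1_g_continuous; lra].
  - intros s hs.
    assert (d1 := denom_le v1 s hs). assert (d2 := denom_le v2 s hs).
    replace (g s / (F s - F c - v1) + -1 * (g s / (F s - F c - v2))) with
      (g s / ((F s - F c - v1) * (F s - F c - v2)) * (v1 - v2)) by (field; lra).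
    rewrite Rabs_mult. apply Rmult_le_compat_r; [apply Rabs_pos|].
    unfold Rdiv. rewrite Rabs_mult.
    assert (hmm : m * m <= (F s - F c - v1) * (F s - F c - v2)).
    { rewrite <- (Rmult_opp_opp (F s - F c - v1)). apply Rmult_le_compat; lra. }
    assert (0 < m * m) by (apply Rmult_lt_0_compat; lra).
    apply Rmult_le_compat; try apply Rabs_pos; [apply hgG; lra|].
    rewrite Rabs_pos_eq.
    + apply Rinv_le_contravar; auto.
    + left; apply Rinv_0_lt_compat; lra.
Qed.

Lemma I_int_continuity_pt (v : R) : 0 < v -> continuity_pt (fun v => I_int F g c v (- a) c) v.
Proof.
  intros hv.
  destruct (I_int_lipschitz (v / 2)) as [C [hC hL]]; [lra|].
  intros e he.
  exists (Rmin (v / 2) (e / C)). split.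
  - apply Rmin_pos; [lra|]. apply Rdiv_lt_0_compat; lra.
  - intros x [_ hx]. simpl in *. unfold Rdist in *.
    assert (hx1 : Rabs (x - v) < v / 2) by (eapply Rlt_le_trans; [exact hx|apply Rmin_l]).
    assert (hx2 : Rabs (x - v) < e / C) by (eapply Rlt_le_trans; [exact hx|apply Rmin_r]).
    apply Rabs_def2 in hx1.
    apply Rle_lt_trans with (C * Rabs (x - v)); [apply hL; lra|].
    replace e with (C * (e / C)) by (field; lra).
    apply Rmult_lt_compat_l; auto.
Qed.

(* [v * I v] tends to [- RInt g (-a) c], which is negative since [g] is odd and positive on [(a,c)]. *)
Lemma I_int_neg_large (v0 : R) : exists v : R, v0 < v /\ 0 < v /\ I_int F g c v (- a) c < 0.
Proof.
  assert (ha : 0 < a) by apply hH. assert (hac := root_c_gt).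
  assert (hm : 0 < RInt g (- a) c).
  { rewrite (RInt_Rchasles g (- a) a c); [|lra|intros; apply H1_g_continuous].
    rewrite RInt_odd; [|lra|apply hH|apply H1_g_continuous].
    assert (0 < RInt g a c); [|lra].
    apply RInt_gt_0; [lra|intros; apply H1_g_pos; lra|intros; apply H1_g_continuous]. }
  set (k := fun s => g s * (F s - F c)).
  assert (hk : forall x, continuous k x).
  { intros x. apply continuous_Rmult; [apply H1_g_continuous|].
    apply continuous_Rminus; [apply H1_F_continuous|apply continuous_const]. }
  destruct (continuous_bounded k (- a) c) as [C [hC hkC]]; [lra|exact hk|].
  (* For [v > B] the error bound [(c + a) * C / v] falls below the integral of [g]. *)
  set (B := (c - - a) * C / RInt g (- a) c).
  assert (hB : 0 < B) by (apply Rdiv_lt_0_compat; auto; apply Rmult_lt_0_compat; lra).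
  set (v := Rmax v0 B + 1).
  assert (hv0 : v0 < v) by (unfold v; generalize (Rmax_l v0 B); lra).
  assert (hvB : B < v) by (unfold v; generalize (Rmax_r v0 B); lra).
  exists v. split; [auto|]. split; [lra|].
  (* From [g + v * g / (F - F c - v) = g * (F - F c) / (F - F c - v)]. *)
  assert (e : RInt g (- a) c + v * I_int F g c v (- a) c =
              RInt (fun s => k s / (F s - F c - v)) (- a) c).
  { unfold I_int. rewrite <- RInt_lin; [|lra|intros; apply H1_g_continuous|].
    2:{ apply quot_continuous; [apply H1_g_continuous|lra]. }
    apply RInt_ext. rewrite Rmin_left, Rmax_right by lra. intros s hs.
    assert (d := denom_le v s). unfold k. simpl. field. lra. }
  assert (hb : Rabs (RInt (fun s => k s / (F s - F c - v)) (- a) c) <= (c - - a) * (C / v)).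
  { apply abs_RInt_le_const; [lra| |].
    - apply ex_RInt_continuous_le; [lra|]. apply quot_continuous; [exact hk|lra].
    - intros s hs. assert (d := denom_le v s hs).
      unfold Rdiv. rewrite Rabs_mult. apply Rmult_le_compat; try apply Rabs_pos; [apply hkC; lra|].
      rewrite Rabs_inv, Rabs_left by lra. apply Rinv_le_contravar; lra. }
  assert (hq : (c - - a) * (C / v) < RInt g (- a) c).
  { replace ((c - - a) * (C / v)) with (B * RInt g (- a) c / v) by (unfold B; field; lra).
    apply Rmult_lt_reg_r with v; [lra|].
    replace (B * RInt g (- a) c / v * v) with (B * RInt g (- a) c) by (field; lra).
    rewrite (Rmult_comm (RInt g (- a) c)). apply Rmult_lt_compat_r; lra. }
  assert (hvI : v * I_int F g c v (- a) c < 0).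
  { apply Rabs_le_between in hb. lra. }
  apply Rnot_le_lt. intros hn.
  assert (0 <= v * I_int F g c v (- a) c) by (apply Rmult_le_pos; lra). lra.
Qed.

(* After subtracting [kappa F'] with [kappa = g b / F' b], the numerator is nonpositive on [[b,c]];
   near [-a] it stays below a negative constant, hence below a multiple [eta F'],
   whose integral is of order [eta ln (1/v)]. *)
Lemma I_int_pos_small (v0 : R) : 0 < v0 ->
  exists v : R, 0 < v < v0 /\ 0 < I_int F g c v (- a) c.
Proof.
  intros hv0.
  assert (ha : 0 < a) by apply hH. assert (hac := root_c_gt).
  destruct zero_b as [b [hb eb]].
  assert (hrb : 0 < ratio b).
  { apply Rdiv_lt_0_compat; [apply H1_Derive_pos|apply H1_g_pos]; lra. }
  set (kappa := / ratio b).
  set (u := fun s => g s - kappa * Derive F s).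
  assert (hu : forall x, continuous u x) by apply H1_comb_continuous.
  assert (hga : 0 < g a) by (apply H1_g_pos; auto).
  (* [F'] vanishes at [- a], so subtracting [kappa F'] leaves the value of [g] unchanged there. *)
  assert (hua : u (- a) = - g a).
  { unfold u. rewrite Derive_odd by apply hH. rewrite (proj1 (proj2 hH)).
    assert (Derive F a = 0) as -> by apply hH. lra. }
  destruct (continuous_eps u (- a) (hu (- a)) (g a / 2)) as [d [hd hde]]; [lra|].
  (* Close enough to [- a] that [u < - g a / 2] on [[-a,p]], and negative, so that [F p > 0]. *)
  set (p := - a + Rmin (d / 2) (a / 2)).
  assert (hp1 : p <= - a + d / 2) by (unfold p; generalize (Rmin_l (d / 2) (a / 2)); lra).
  assert (hp2 : p <= - a + a / 2) by (unfold p; generalize (Rmin_r (d / 2) (a / 2)); lra).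
  assert (hp3 : - a < p).
  { unfold p. assert (0 < Rmin (d / 2) (a / 2)) by (apply Rmin_pos; lra). lra. }
  destruct (continuous_bounded (Derive F) (- a) p) as [L [hL hFL]]; [lra|apply H1_Derive_continuous|].
  (* Since [F' >= - L] on [[-a,p]], this gives [eta F' >= - g a / 2], which dominates [u]. *)
  set (eta := g a / 2 / L).
  assert (heta : 0 < eta) by (apply Rdiv_lt_0_compat; lra).
  assert (hleft : forall s, - a <= s <= p -> u s <= eta * Derive F s).
  { intros s hs.
    assert (h1 : Rabs (s - - a) < d) by (apply Rabs_def1; lra).
    specialize (hde s h1). apply Rabs_def2 in hde.
    specialize (hFL s hs). apply Rabs_le_between in hFL.
    assert (eta * - L <= eta * Derive F s) by (apply Rmult_le_compat_l; lra).
    assert (eta * L = g a / 2) by (unfold eta; field; lra). lra. }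
  set (m := F c - F p).
  assert (hm : 0 < m) by (unfold m; generalize (lt_F_c p); lra).
  assert (hFp : 0 < F p).
  { replace p with (- - p) by lra. rewrite (proj1 hH (- p)).
    assert (F (- p) < 0) by (apply H1_neg; lra). lra. }
  assert (hmid : forall s, p <= s <= b -> m <= F c - F s).
  { intros s hs. unfold m. enough (F s <= F p) by lra.
    destruct (Rle_lt_dec s 0) as [h|h].
    - replace s with (- - s) by lra. replace p with (- - p) by lra.
      rewrite (proj1 hH (- s)), (proj1 hH (- p)).
      destruct (proj1 hs) as [h'|h']; [|rewrite h'; lra].
      assert (F (- p) < F (- s)) by (apply H1_decr; lra). lra.
    - destruct (Rle_lt_dec s a) as [h'|h'].
      + assert (F s < 0) by (apply H1_neg; lra). lra.
      + destruct (proj2 hs) as [h''|h'']; [|rewrite h''; lra].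
        assert (F s < F b) by (apply H1_incr; lra). lra. }
  destruct (continuous_bounded u p b) as [C [hC huC]]; [lra|exact hu|].
  assert (hright : forall s, b <= s <= c -> u s <= 0).
  { intros s hs. unfold u, kappa.
    assert (hgs : 0 < g s) by (apply H1_g_pos; lra).
    assert (ed : Derive F s = ratio s * g s) by (unfold ratio; field; lra).
    rewrite ed.
    replace (g s - / ratio b * (ratio s * g s)) with
      (- (g s * / ratio b * (ratio s - ratio b))) by (field; lra).
    assert (ratio b <= ratio s) by (apply ratio_mono; lra).
    assert (0 < / ratio b) by (apply Rinv_0_lt_compat; auto).
    assert (0 <= g s * / ratio b * (ratio s - ratio b)); [|lra].
    apply Rmult_le_pos; [apply Rmult_le_pos; lra|lra]. }
  (* Bound for the integral over [[p,b]]: there [|u| <= C] and the denominator has absolute value at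
     least [m]. *)
  set (Q := (b - p) * (C / m)).
  assert (hQ : 0 < Q).
  { apply Rmult_lt_0_compat; [lra|apply Rdiv_lt_0_compat; lra]. }
  (* Makes [ln m - ln v] at least [Q / eta + 1], so the contribution near [- a] is at least
     [Q + eta] and outweighs the loss [Q]. *)
  set (v := Rmin (v0 / 2) (m * exp (- (Q / eta + 1)))).
  assert (hme : 0 < m * exp (- (Q / eta + 1))) by (apply Rmult_lt_0_compat; [lra|apply exp_pos]).
  assert (hv : 0 < v) by (apply Rmin_pos; lra).
  assert (hvv : v <= v0 / 2) by apply Rmin_l.
  assert (hlv : ln v <= ln m - (Q / eta + 1)).
  { apply Rle_trans with (ln (m * exp (- (Q / eta + 1)))).
    - apply ln_le; [auto|apply Rmin_r].
    - rewrite ln_mult, ln_exp; [lra|lra|apply exp_pos]. }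
  exists v. split; [lra|].
  rewrite (I_int_shift kappa v hv). fold u.
  change (fun s => (g s - kappa * Derive F s) / (F s - F c - v))
    with (fun s => u s / (F s - F c - v)).
  assert (hqc := quot_continuous u v hu hv).
  rewrite (RInt_Rchasles _ (- a) p c), (RInt_Rchasles _ p b c); try lra;
    try (intros; apply hqc; lra).
  assert (i1 : eta * (ln m - ln v) <= RInt (fun s => u s / (F s - F c - v)) (- a) p).
  { assert (hqd : forall s, - a <= s <= c -> continuous (fun s => Derive F s / (F s - F c - v)) s).
    { apply quot_continuous; [apply H1_Derive_continuous|auto]. }
    (* The denominator is negative, so [u <= eta F'] reverses after division. Because
       [F (-a) = F c], the logarithm at the left endpoint is exactly [ln v]. *)
    apply Rle_trans with (eta * RInt (fun s => Derive F s / (F s - F c - v)) (- a) p).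
    - rewrite RInt_log by lra. apply Rmult_le_compat_l; [lra|].
      destruct hc as [_ <-].
      replace (F c + v - F c) with v by ring.
      assert (ln m <= ln (F c + v - F p)); [|lra].
      apply ln_le; [auto|unfold m; lra].
    - apply Rminus_le_0.
      replace (RInt (fun s => u s / (F s - F c - v)) (- a) p -
               eta * RInt (fun s => Derive F s / (F s - F c - v)) (- a) p) with
        (RInt (fun s => u s / (F s - F c - v) + - eta * (Derive F s / (F s - F c - v))) (- a) p).
      2:{ rewrite RInt_lin; [lra|lra| |]; intros; [apply hqc|apply hqd]; lra. }
      apply RInt_nonneg; [lra| |].
      + intros s hs.
        apply (continuous_plus (fun s => u s / (F s - F c - v))
           (fun s => - eta * (Derive F s / (F s - F c - v)))); [apply hqc; lra|].
        apply continuous_Rmult; [apply continuous_const|apply hqd; lra].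
      + intros s hs. assert (hd' := denom_le v s).
        replace (u s / (F s - F c - v) + - eta * (Derive F s / (F s - F c - v))) with
          ((eta * Derive F s - u s) / - (F s - F c - v)) by (field; lra).
        apply Rdiv_le_0_compat; [|lra]. assert (hl := hleft s). lra. }
  assert (i2 : - Q <= RInt (fun s => u s / (F s - F c - v)) p b).
  { assert (h : Rabs (RInt (fun s => u s / (F s - F c - v)) p b) <= Q).
    - apply abs_RInt_le_const; [lra| |].
      + apply ex_RInt_continuous_le; [lra|]. intros; apply hqc; lra.
      + intros s hs. assert (hd' := hmid s hs).
        unfold Rdiv. rewrite Rabs_mult.
        apply Rmult_le_compat; try apply Rabs_pos; [apply huC; lra|].
        rewrite Rabs_inv, Rabs_left by lra. apply Rinv_le_contravar; lra.
    - apply Rabs_le_between in h. lra. }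
  assert (i3 : 0 <= RInt (fun s => u s / (F s - F c - v)) b c).
  { apply RInt_nonneg; [lra|intros; apply hqc; lra|].
    intros s hs. assert (hd' := denom_le v s). assert (hr := hright s).
    replace (u s / (F s - F c - v)) with (- u s / - (F s - F c - v)) by (field; lra).
    apply Rdiv_le_0_compat; lra. }
  assert (i4 : eta * (Q / eta + 1) <= eta * (ln m - ln v)) by (apply Rmult_le_compat_l; lra).
  replace (eta * (Q / eta + 1)) with (Q + eta) in i4 by (field; lra).
  lra.
Qed.

End Shape.

(** * Existence and uniqueness of the zero, and the sign change *)

Theorem theorem1p3 (F g : R -> R) (a c : R)
  (hH1 : H1 F g a) (hc : positive_root_c F a c) (hH2 : H2 F g c) :
  exists v0 : R,
    (0 < v0 /\ I_int F g c v0 (- a) c = 0) /\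
    (forall v : R, 0 < v -> I_int F g c v (- a) c = 0 -> v = v0) /\
    changes_sign_at (fun v => I_int F g c v (- a) c) v0.
Proof.
  destruct (I_int_neg_large F g a hH1 c hc 1) as [v2 [hv2 [_ hI2]]].
  destruct (I_int_pos_small F g a hH1 c hc hH2 1) as [v1 [hv1 hI1]]; [lra|].
  destruct (sign_comparison F g a hH1 c hc hH2) as [kappa [w0 [hw0 [h0 hp]]]].
  assert (hN := weighted_I_decr F g a hH1 c hc kappa w0 h0 hp).
  assert (hcont := I_int_continuity_pt F g a hH1 c hc).
  set (J := fun v => I_int F g c v (- a) c) in *.
  (* [J] goes from positive at [v1] to negative at [v2]; the negation gives the orientation that
     [IVT_interv] expects. *)
  destruct (IVT_interv (fun v => - J v) v1 v2) as [v0 [hv0 e0]].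
  { intros v hv. apply (continuity_pt_opp J), hcont. lra. }
  { lra. }
  { unfold J. lra. }
  { unfold J. lra. }
  assert (e : J v0 = 0) by lra.
  (* The weighted integral is strictly decreasing and vanishes at [v0], and its weight
     [F c + v - w0] is positive because [w0 <= F c]; so the sign of [J] is determined on either
     side. *)
  assert (hlo : forall v, 0 < v < v0 -> 0 < J v).
  { intros v hv. specialize (hN v v0). fold (J v0) (J v) in hN. rewrite e in hN.
    apply Rnot_le_lt. intros hn.
    assert (0 <= (F c + v - w0) * - J v) by (apply Rmult_le_pos; lra). lra. }
  assert (hhi : forall v, v0 < v -> J v < 0).
  { intros v hv. specialize (hN v0 v). fold (J v0) (J v) in hN. rewrite e in hN.
    apply Rnot_le_lt. intros hn.
    assert (0 <= (F c + v - w0) * J v) by (apply Rmult_le_pos; lra). lra. }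
  exists v0. split; [split; [lra|exact e]|]. split.
  - intros v hv ev. fold (J v) in ev.
    destruct (Rtotal_order v v0) as [h|[h|h]]; [|exact h|].
    + generalize (hlo v). lra.
    + generalize (hhi v h). lra.
  (* The radius [v0] keeps the left neighbourhood inside the positive levels. *)
  - exists v0. split; [lra|]. right. intros x y hx hy.
    split; [apply hlo|apply hhi]; lra.
Qed.
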